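(* Let $X$ be a locally path connected space, let $x\in X$, and let $H$ be a subgroup of $\pi_1(X,x)$. Then there exists an open cover $\mathcal{U}$ of $X$ such that $\pi(\mathcal{U},x)\leq H$ if and only if the core of $H$ in $\pi_1(X,x)$ is open in $\pi_1^{qtop}(X,x)$.
   Context: The quasitopological fundamental group $\pi_1^{qtop}(X,x)$ is the group $\pi_1(X,x)$ with the quotient topology induced by the map $q:\Omega(X,x)\to\pi_1(X,x)$, $q(\gamma)=[\gamma]$, where $\Omega(X,x)$ is the space of loops in $X$ based at $x$ with the compact-open topology. For a subgroup $H$ of a group $G$, the core of $H$ in $G$ is $H_G=\bigcap_{g\in G}g^{-1}Hg$, the largest normal subgroup of $G$ contained in $H$. For an open cover $\mathcal{U}=\{U_i\mid i\in I\}$ of $X$, the Spanier group $\pi(\mathcal{U},x)$ is the subgroup of $\pi_1(X,x)$ consisting of all homotopy classes having a representative of the form $\prod_{j=1}^{n}u_jv_ju_j^{-1}$, where each $u_j$ is an arbitrary path starting at $x$ and each $v_j$ is a loop based at $u_j(1)$ lying inside one of the open sets of $\mathcal{U}$. *)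

(* Defs.v *)
From HB Require Import structures.
From mathcomp Require Import all_boot all_order all_algebra.
From mathcomp Require Import all_classical reals topology.
From mathcomp Require Import normedtype homotopy.
From mathcomp Require Import lra.

Set Implicit Arguments.
Unset Strict Implicit.
Unset Printing Implicit Defensive.

Import Order.TTheory GRing.Theory Num.Theory.
Import numFieldNormedType.Exports.

Local Open Scope classical_set_scope.
Local Open Scope ring_scope.
Local Open Scope quotient_scope.

Section unit_interval.
Context (R : realType).

Definition unit_itv : Type := @set_type R `[0, 1]%classic.

HB.instance Definition _ :=
  Topological.copy unit_itv (@set_type R `[0, 1]%classic).

Definition itv_val (t : unit_itv) : R := set_val t.

Lemma clamp_subproof (r : R) :
  Num.max 0 (Num.min 1 r) \in (`[0, 1]%classic : set R).
Proof.
by rewrite inE/= in_itv/= le_max lexx/= ge_max ler01 ge_min lexx.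
Qed.

Definition clamp (r : R) : unit_itv :=
  @exist R (fun t => t \in `[0, 1]%classic) _
    (clamp_subproof r).

Lemma itv_valP (t : unit_itv) : 0 <= itv_val t <= 1.
Proof. by by have := set_valP t; rewrite /= in_itv. Qed.

Lemma itv_val_ge0 (t : unit_itv) : 0 <= itv_val t.
Proof. by case/andP: (itv_valP t). Qed.

Lemma itv_val_le1 (t : unit_itv) : itv_val t <= 1.
Proof. by case/andP: (itv_valP t). Qed.

Lemma itv_val_inj : injective itv_val.
Proof. by move=> [s ps] [t pt] /= st; exact: eq_exist. Qed.

Lemma clampE (r : R) : itv_val (clamp r) = Num.max 0 (Num.min 1 r).
Proof. by []. Qed.

Lemma clampK (r : R) : 0 <= r <= 1 -> itv_val (clamp r) = r.
Proof. by move=> /andP[r0 r1]; rewrite clampE min_r// max_r. Qed.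

Lemma itv_valK : cancel itv_val clamp.
Proof. by move=> t; apply/itv_val_inj/clampK/itv_valP. Qed.

Lemma itv_val_continuous : continuous itv_val.
Proof. exact: initial_continuous. Qed.

Lemma clamp_continuous : continuous clamp.
Proof.
apply: continuous_comp_initial => r /=.
apply: (@continuous_max _ _ (fun=> 0) _ r); first exact: cst_continuous.
by apply: (@continuous_min _ _ (fun=> 1) _ r); [exact: cst_continuous|].
Qed.

Lemma itv01_neq : clamp 0 != clamp 1.
Proof.
apply/eqP => /(congr1 itv_val); rewrite !clampK ?lexx ?ler01//.
by move/eqP; rewrite eq_sym oner_eq0.
Qed.

HB.instance Definition _ := @isBiPointed.Build unit_itv _ _ itv01_neq.

Lemma itv_val0 : itv_val zero = 0.
Proof. by rewrite clampK// lexx ler01. Qed.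

Lemma itv_val1 : itv_val one = 1.
Proof. by rewrite clampK// lexx ler01. Qed.

End unit_interval.

Arguments itv_val {R}.

Notation upath R x y := {path (unit_itv R) from x to y}.

Lemma continuous_if_le (R : realType) (Z X : topologicalType)
    (a : Z -> R) (c : R) (f g : Z -> X) :
    continuous a -> continuous f -> continuous g ->
    (forall z, a z = c -> f z = g z) ->
  continuous (fun z => if a z <= c then f z else g z).
Proof.
move=> ca cf cg fg.
pose A := a @^-1` [set r | r <= c]; pose B := a @^-1` [set r | c <= r].
have cA : closed A by move/continuous_closedP: ca; apply; exact: closed_le.
have cB : closed B by move/continuous_closedP: ca; apply; exact: closed_ge.
have ABT : A `|` B = setT.
  by rewrite -subTset => z _; case: (leP (a z) c) => [|/ltW]; [left|right].
apply/continuous_subspace_setT; rewrite -ABT; apply: withinU_continuous => //.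
- apply: (@subspace_eq_continuous _ A _ f); last exact: continuous_subspaceT.
  by move=> z /set_mem az; rewrite /from_subspace ifT.
- apply: (@subspace_eq_continuous _ B _ g); last exact: continuous_subspaceT.
  move=> z /set_mem cz; rewrite /from_subspace; case: ifPn => // zc.
  by rewrite fg//; apply/eqP; rewrite eq_le zc.
Qed.

Section continuous_combinators.
Context (R : realType) (Z Y X : topologicalType).

Lemma continuous_comp_fun (f : Z -> Y) (g : Y -> X) :
  continuous f -> continuous g -> continuous (fun z => g (f z)).
Proof. by move=> cf cg z; apply: continuous_comp; [exact: cf|exact: cg]. Qed.

Lemma continuous_pair_fun (f : Z -> Y) (g : Z -> X) :
  continuous f -> continuous g -> continuous (fun z => (f z, g z)).
Proof. by move=> cf cg z; apply: cvg_pair; [exact: cf|exact: cg]. Qed.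

Lemma continuous_aff_fun (a b : R) (f : Z -> R) :
  continuous f -> continuous (fun z => a * f z + b).
Proof.
move=> cf z; apply: cvgD; last exact: cvg_cst.
by apply: cvgM; [exact: cvg_cst|exact: cf].
Qed.

Lemma continuous_segment_fun (s f g : Z -> R) :
    continuous s -> continuous f -> continuous g ->
  continuous (fun z => (1 - s z) * f z + s z * g z).
Proof.
move=> cs cf cg z; apply: cvgD; apply: cvgM; [|exact: cf|exact: cs|exact: cg].
by apply: cvgB; [exact: cvg_cst|exact: cs].
Qed.

Lemma continuous_max_fun (f g : Z -> R) :
  continuous f -> continuous g -> continuous (fun z => Num.max (f z) (g z)).
Proof.
by move=> cf cg z; apply: (@continuous_max _ _ f g); [exact: cf|exact: cg].
Qed.

Lemma continuous_min_fun (f g : Z -> R) :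
  continuous f -> continuous g -> continuous (fun z => Num.min (f z) (g z)).
Proof.
by move=> cf cg z; apply: (@continuous_min _ _ f g); [exact: cf|exact: cg].
Qed.

End continuous_combinators.

Section path_operations.
Context (R : realType) (X : topologicalType).
Local Notation I := (unit_itv R).

Definition concat_fun (p q : I -> X) (t : I) : X :=
  if itv_val t <= 2^-1 then p (clamp (2 * itv_val t))
  else q (clamp (2 * itv_val t - 1)).

Lemma itv_val_aff (a b : R) : continuous (fun t : I => a * itv_val t + b).
Proof. exact/continuous_aff_fun/itv_val_continuous. Qed.

Lemma path_clamp_continuous (x y : X) (p : upath R x y) (f : I -> R) :
  continuous f -> continuous (fun t => p (clamp (f t))).
Proof.
move=> cf; apply: (@continuous_comp_fun _ _ _ (@clamp R \o f) p).
  exact: (continuous_comp_fun cf (@clamp_continuous R)).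
exact: cts_fun.
Qed.

Section concat.
Context {x y z : X} (p : upath R x y) (q : upath R y z).

Lemma concat_continuous : continuous (concat_fun p q).
Proof.
apply: continuous_if_le.
- exact: itv_val_continuous.
- apply: path_clamp_continuous; under eq_fun do rewrite -[_ * _]addr0.
  exact: itv_val_aff.
- by apply: path_clamp_continuous; exact: itv_val_aff.
- move=> t ->; rewrite divff ?pnatr_eq0// subrr.
  by rewrite [LHS]path_one [RHS]path_zero.
Qed.

Lemma concat_zero : concat_fun p q zero = x.
Proof.
by rewrite /concat_fun itv_val0 invr_ge0 ler0n mulr0 [LHS]path_zero.
Qed.

Lemma concat_one : concat_fun p q one = z.
Proof.
rewrite /concat_fun itv_val1 ifF; last by apply/negbTE; rewrite -ltNge; lra.
by rewrite (_ : 2 * 1 - 1 = 1) ?[LHS]path_one//; lra.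
Qed.

Definition concat : upath R x z :=
  mk_path concat_continuous concat_zero concat_one.

End concat.

Section reverse.
Context {x y : X} (p : upath R x y).

Definition reverse_fun (t : I) : X := p (clamp (1 - itv_val t)).

Lemma reverse_continuous : continuous reverse_fun.
Proof.
apply: path_clamp_continuous.
under eq_fun do rewrite addrC -mulN1r.
exact: itv_val_aff.
Qed.

Lemma reverse_zero : reverse_fun zero = y.
Proof. by rewrite /reverse_fun itv_val0 subr0 [LHS]path_one. Qed.

Lemma reverse_one : reverse_fun one = x.
Proof. by rewrite /reverse_fun itv_val1 subrr [LHS]path_zero. Qed.

Definition reverse : upath R y x :=
  mk_path reverse_continuous reverse_zero reverse_one.

End reverse.

Definition cst_path (x : X) : upath R x x := cst x.

Definition path_homotopic {x y : X} (p q : upath R x y) : Prop :=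
  exists F : I * I -> X, [/\ continuous F,
    forall t, F (t, zero) = p t, forall t, F (t, one) = q t,
    forall s, F (zero, s) = x & forall s, F (one, s) = y].

(* Two reparametrizations of the same map with the same endpoints are
   homotopic by the straight-line homotopy of the parameters; every group law
   is an instance of this. *)
Lemma path_homotopic_param {x y : X} (p q : upath R x y)
    (h : R -> X) (phi psi : I -> R) :
    continuous h -> continuous phi -> continuous psi ->
    (forall t, p t = h (phi t)) -> (forall t, q t = h (psi t)) ->
    phi zero = psi zero -> phi one = psi one ->
  path_homotopic p q.
Proof.
move=> ch cphi cpsi pE qE e0 e1.
exists (fun ts => h ((1 - itv_val ts.2) * phi ts.1 + itv_val ts.2 * psi ts.1)).
split.
- apply: continuous_comp_fun; last exact: ch.
  apply: continuous_segment_fun.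
  + apply: (continuous_comp_fun _ (@itv_val_continuous R)) => ts.
    exact: cvg_snd.
  + by apply: (continuous_comp_fun _ cphi) => ts; exact: cvg_fst.
  + by apply: (continuous_comp_fun _ cpsi) => ts; exact: cvg_fst.
- by move=> t /=; rewrite itv_val0 subr0 mul1r mul0r addr0.
- by move=> t /=; rewrite itv_val1 subrr mul1r mul0r add0r.
- move=> s /=; rewrite -e0 -mulrDl subrK mul1r -pE; exact: path_zero.
- move=> s /=; rewrite -e1 -mulrDl subrK mul1r -pE; exact: path_one.
Qed.

Lemma path_homotopic_refl {x y : X} (p : upath R x y) : path_homotopic p p.
Proof.
exists (p \o fst); split => //.
- apply: (@continuous_comp_fun _ _ _ fst p); last exact: cts_fun.
  by move=> ts; exact: cvg_fst.
- by move=> s; exact: path_zero.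
- by move=> s; exact: path_one.
Qed.

Lemma eqfun_homotopic {x y : X} (p q : upath R x y) :
  p =1 q -> path_homotopic p q.
Proof. by move/path_eqP ->; exact: path_homotopic_refl. Qed.

Lemma reparam_pair_continuous (F : I * I -> X) (f g : I * I -> R) :
    continuous F -> continuous f -> continuous g ->
  continuous (fun ts => F (clamp (f ts), clamp (g ts))).
Proof.
move=> cF cf cg; apply: (continuous_comp_fun _ cF).
by apply: continuous_pair_fun;
  apply: (continuous_comp_fun _ (@clamp_continuous R)).
Qed.

Lemma fst_aff (a b : R) :
  continuous (fun ts : I * I => a * itv_val ts.1 + b).
Proof.
by apply: (continuous_comp_fun _ (@itv_val_aff a b)) => ts; exact: cvg_fst.
Qed.

Lemma snd_aff (a b : R) :
  continuous (fun ts : I * I => a * itv_val ts.2 + b).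
Proof.
by apply: (continuous_comp_fun _ (@itv_val_aff a b)) => ts; exact: cvg_snd.
Qed.

Lemma aff_id (r : R) : 1 * r + 0 = r.
Proof. by rewrite mul1r addr0. Qed.

Lemma path_homotopic_sym {x y : X} (p q : upath R x y) :
  path_homotopic p q -> path_homotopic q p.
Proof.
move=> [F [cF F0 F1 Fx Fy]].
exists (fun ts => F (clamp (1 * itv_val ts.1 + 0),
                     clamp (-1 * itv_val ts.2 + 1))).
split.
- by apply: reparam_pair_continuous => //; [exact: fst_aff|exact: snd_aff].
- move=> t /=; rewrite aff_id itv_valK itv_val0 mulr0 add0r; exact: F1.
- move=> t /=; rewrite aff_id itv_valK itv_val1 mulr1 addNr; exact: F0.
- move=> s /=; rewrite aff_id itv_valK; exact: Fx.
- move=> s /=; rewrite aff_id itv_valK; exact: Fy.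
Qed.

Lemma path_homotopic_trans {x y : X} (p q r : upath R x y) :
  path_homotopic p q -> path_homotopic q r -> path_homotopic p r.
Proof.
move=> [F [cF F0 F1 Fx Fy]] [G [cG G0 G1 Gx Gy]].
exists (fun ts => if itv_val ts.2 <= 2^-1
  then F (clamp (1 * itv_val ts.1 + 0), clamp (2 * itv_val ts.2 + 0))
  else G (clamp (1 * itv_val ts.1 + 0), clamp (2 * itv_val ts.2 + -1))).
split.
- apply: continuous_if_le.
  + by under eq_fun do rewrite -[itv_val _]aff_id; exact: snd_aff.
  + by apply: reparam_pair_continuous => //; [exact: fst_aff|exact: snd_aff].
  + by apply: reparam_pair_continuous => //; [exact: fst_aff|exact: snd_aff].
  + move=> ts ->; rewrite !aff_id ?itv_valK divff ?pnatr_eq0// addr0 subrr.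
    by rewrite [LHS]F1 [RHS]G0.
- move=> t /=; rewrite itv_val0 invr_ge0 ler0n aff_id itv_valK mulr0 addr0.
  exact: F0.
- move=> t /=; rewrite itv_val1 ifF; last by apply/negbTE; rewrite -ltNge; lra.
  rewrite (_ : 2 * 1 + -1 = 1); last lra.
  rewrite aff_id itv_valK; exact: G1.
- by move=> s /=; rewrite aff_id itv_valK Fx Gx if_same.
- by move=> s /=; rewrite aff_id itv_valK Fy Gy if_same.
Qed.

Lemma concat_homotopic {x y z : X} (p p' : upath R x y) (q q' : upath R y z) :
  path_homotopic p p' -> path_homotopic q q' ->
  path_homotopic (concat p q) (concat p' q').
Proof.
move=> [F [cF F0 F1 Fx Fy]] [G [cG G0 G1 Gx Gy]].
exists (fun ts => if itv_val ts.1 <= 2^-1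
  then F (clamp (2 * itv_val ts.1 + 0), clamp (1 * itv_val ts.2 + 0))
  else G (clamp (2 * itv_val ts.1 + -1), clamp (1 * itv_val ts.2 + 0))).
split.
- apply: continuous_if_le.
  + by under eq_fun do rewrite -[itv_val _]aff_id; exact: fst_aff.
  + by apply: reparam_pair_continuous => //; [exact: fst_aff|exact: snd_aff].
  + by apply: reparam_pair_continuous => //; [exact: fst_aff|exact: snd_aff].
  + move=> ts ->; rewrite !aff_id ?itv_valK divff ?pnatr_eq0// addr0 subrr.
    by rewrite [LHS]Fy [RHS]Gx.
- move=> t; rewrite [(t, zero).1]/= [(t, zero).2]/= aff_id itv_valK F0 G0.
  by rewrite addr0.
- move=> t; rewrite [(t, one).1]/= [(t, one).2]/= aff_id itv_valK F1 G1.
  by rewrite addr0.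
- move=> s /=; rewrite itv_val0 invr_ge0 ler0n mulr0 addr0; exact: Fx.
- move=> s /=; rewrite itv_val1 ifF; last by apply/negbTE; rewrite -ltNge; lra.
  rewrite (_ : 2 * 1 + -1 = 1); [exact: Gy|lra].
Qed.

Lemma reverse_homotopic {x y : X} (p q : upath R x y) :
  path_homotopic p q -> path_homotopic (reverse p) (reverse q).
Proof.
move=> [F [cF F0 F1 Fx Fy]].
exists (fun ts => F (clamp (-1 * itv_val ts.1 + 1),
                     clamp (1 * itv_val ts.2 + 0))).
split.
- by apply: reparam_pair_continuous => //; [exact: fst_aff|exact: snd_aff].
- move=> t; rewrite [(t, zero).1]/= [(t, zero).2]/= aff_id itv_valK F0.
  by rewrite mulN1r addrC.
- move=> t; rewrite [(t, one).1]/= [(t, one).2]/= aff_id itv_valK F1.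
  by rewrite mulN1r addrC.
- move=> s /=; rewrite itv_val0 mulr0 add0r; exact: Fy.
- move=> s /=; rewrite itv_val1 mulr1 addNr; exact: Fx.
Qed.

Lemma path_ext_continuous {x y : X} (p : upath R x y) :
  continuous (p \o @clamp R).
Proof.
by apply: (continuous_comp_fun (@clamp_continuous R)); exact: cts_fun.
Qed.

Lemma concatA_homotopic {x y z w : X}
    (p : upath R x y) (q : upath R y z) (r : upath R z w) :
  path_homotopic (concat p (concat q r)) (concat (concat p q) r).
Proof.
pose phi (t : I) : R := Num.max (2^-1 * itv_val t + 0)
  (Num.max (1 * itv_val t + - 4^-1) (2 * itv_val t + -1)).
apply: (@path_homotopic_param _ _ _ _
  (concat (concat p q) r \o @clamp R) phi itv_val).
- exact: path_ext_continuous.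
- apply: continuous_max_fun; first exact: itv_val_aff.
  by apply: continuous_max_fun; exact: itv_val_aff.
- exact: itv_val_continuous.
- move=> t /=.
  have /andP[t0 t1] := itv_valP t.
  have [t12|t12] := leP (itv_val t) (2^-1).
    have -> : phi t = 2^-1 * itv_val t.
      rewrite /phi mul1r addr0 max_l// ge_max; apply/andP; split; lra.
    rewrite /concat/= /mk_path /concat_fun t12 clampK; last first.
      by apply/andP; split; lra.
    rewrite ifT; last by lra.
    rewrite mulrA mulfV ?pnatr_eq0// mul1r ifT; last first.
      by rewrite itv_valK.
    by rewrite itv_valK.
  have [t34|t34] := leP (itv_val t) (3 / 4).
    have -> : phi t = itv_val t - 4^-1.
      rewrite /phi mul1r [X in Num.max _ X]max_l; last lra.
      rewrite max_r//; lra.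
    rewrite /concat/= /mk_path /concat_fun ifF; last first.
      by apply/negbTE; rewrite -ltNge.
    rewrite !clampK; try (apply/andP; split; lra).
    rewrite ifT; last lra.
    rewrite ifT; last lra.
    rewrite ifF; last by apply/negbTE; rewrite -ltNge; lra.
    by congr (q (clamp _)); lra.
  have -> : phi t = 2 * itv_val t - 1.
    rewrite /phi mul1r [X in Num.max _ X]max_r; last lra.
    rewrite max_r//; lra.
  rewrite /concat/= /mk_path /concat_fun ifF; last first.
    by apply/negbTE; rewrite -ltNge.
  rewrite (@clampK _ (2 * _ - 1)); last by apply/andP; split; lra.
  rewrite ifF; last by apply/negbTE; rewrite -ltNge; lra.
  by rewrite ifF//; apply/negbTE; rewrite -ltNge; lra.
- by move=> t /=; rewrite itv_valK.
- by rewrite /phi itv_val0 !mulr0 !add0r [X in Num.max _ X]max_l ?max_l//; lra.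
- by rewrite /phi itv_val1 [X in Num.max _ X]max_r ?max_r//; lra.
Qed.

Lemma concat1p_homotopic {x y : X} (p : upath R x y) :
  path_homotopic (concat (cst_path x) p) p.
Proof.
apply: (@path_homotopic_param _ _ _ _ (p \o @clamp R)
  (fun t => Num.max (0 * itv_val t + 0) (2 * itv_val t + -1)) itv_val).
- exact: path_ext_continuous.
- by apply: continuous_max_fun; exact: itv_val_aff.
- exact: itv_val_continuous.
- move=> t /=; rewrite /concat/= /mk_path /concat_fun mul0r addr0.
  case: leP => t12; last by rewrite max_r//; lra.
  rewrite max_l; last lra.
  by rewrite [RHS]path_zero.
- by move=> t /=; rewrite itv_valK.
- by rewrite itv_val0 max_l//; lra.
- by rewrite itv_val1 max_r//; lra.
Qed.

Lemma concatp1_homotopic {x y : X} (p : upath R x y) :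
  path_homotopic (concat p (cst_path y)) p.
Proof.
apply: (@path_homotopic_param _ _ _ _ (p \o @clamp R)
  (fun t => Num.min (0 * itv_val t + 1) (2 * itv_val t + 0)) itv_val).
- exact: path_ext_continuous.
- by apply: continuous_min_fun; exact: itv_val_aff.
- exact: itv_val_continuous.
- move=> t /=; rewrite /concat/= /mk_path /concat_fun mul0r addr0 add0r.
  case: leP => t12; first by rewrite min_r//; lra.
  rewrite min_l; last lra.
  by rewrite [RHS]path_one.
- by move=> t /=; rewrite itv_valK.
- by rewrite itv_val0 min_r//; lra.
- by rewrite itv_val1 min_l//; lra.
Qed.

Lemma concatVp_homotopic {x y : X} (p : upath R x y) :
  path_homotopic (concat (reverse p) p) (cst_path y).
Proof.
apply: (@path_homotopic_param _ _ _ _ (p \o @clamp R)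
  (fun t => Num.max (-2 * itv_val t + 1) (2 * itv_val t + -1))
  (fun t => 0 * itv_val t + 1)).
- exact: path_ext_continuous.
- by apply: continuous_max_fun; exact: itv_val_aff.
- exact: itv_val_aff.
- move=> t /=; have /andP[t0 t1] := itv_valP t.
  rewrite /concat/= /mk_path /concat_fun.
  case: leP => t12; last by rewrite max_r//; lra.
  rewrite max_l; last lra.
  rewrite /reverse/= /mk_path /reverse_fun clampK; last first.
    by apply/andP; split; lra.
  by congr (p (clamp _)); lra.
- by move=> t /=; rewrite mul0r add0r [RHS]path_one.
- by rewrite itv_val0 max_l//; lra.
- by rewrite itv_val1 max_r//; lra.
Qed.

Lemma reverseK {x y : X} (p : upath R x y) : reverse (reverse p) = p.
Proof.
apply/path_eqP => t; rewrite /reverse/= /mk_path /reverse_fun/=.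
rewrite /reverse/= /mk_path /reverse_fun.
have /andP[t0 t1] := itv_valP t.
rewrite clampK; last by apply/andP; split; lra.
by rewrite subKr itv_valK.
Qed.

Lemma reverse_concat {x y z : X} (p : upath R x y) (q : upath R y z) :
  reverse (concat p q) = concat (reverse q) (reverse p).
Proof.
apply/path_eqP => t; have /andP[t0 t1] := itv_valP t.
rewrite /concat/= /mk_path /concat_fun /reverse/= /mk_path /reverse_fun.
rewrite clampK; last by apply/andP; split; lra.
have [t12|t12|t12] := ltgtP (itv_val t) 2^-1.
- rewrite ifF; last by apply/negbTE; rewrite -ltNge; lra.
  rewrite clampK; last by apply/andP; split; lra.
  by congr (q (clamp _)); lra.
- rewrite ifT; last lra.
  rewrite clampK; last by apply/andP; split; lra.
  by congr (p (clamp _)); lra.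
- rewrite t12 ifT; last lra.
  rewrite (_ : 2 * (1 - 2^-1) = 1); last lra.
  rewrite clampK; last by apply/andP; split; lra.
  rewrite (_ : 1 - 2 * 2^-1 = 0); last lra.
  by rewrite [LHS]path_one [RHS]path_zero.
Qed.

Lemma concatpV_homotopic {x y : X} (p : upath R x y) :
  path_homotopic (concat p (reverse p)) (cst_path x).
Proof.
by have := concatVp_homotopic (reverse p); rewrite reverseK.
Qed.

End path_operations.

Section fundamental_group.
Context (R : realType) (X : topologicalType) (x : X).
Local Notation loop := (upath R x x).

Let homotopicb (p q : loop) : bool := `[< path_homotopic p q >].

Lemma homotopicb_refl : reflexive homotopicb.
Proof. by move=> p; apply/asboolP/path_homotopic_refl. Qed.

Lemma homotopicb_sym : symmetric homotopicb.
Proof.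
by move=> p q; apply/asboolP/asboolP => ?; exact: path_homotopic_sym.
Qed.

Lemma homotopicb_trans : transitive homotopicb.
Proof.
move=> q p r /asboolP pq /asboolP qr; apply/asboolP.
exact: path_homotopic_trans pq qr.
Qed.

Definition loop_homotopy : equiv_rel loop :=
  EquivRel homotopicb homotopicb_refl homotopicb_sym homotopicb_trans.

Definition pi1 : Type := {eq_quot loop_homotopy}.

HB.instance Definition _ := Choice.on pi1.
HB.instance Definition _ := Quotient.on pi1.

Definition loop_class (p : loop) : pi1 := \pi_pi1 p.

Lemma loop_classP (p q : loop) :
  loop_class p = loop_class q <-> path_homotopic p q.
Proof.
split; first by move=> /eqquotP/asboolP.
by move=> pq; apply/eqquotP/asboolP.
Qed.

Lemma loop_class_repr (a : pi1) : loop_class (repr a) = a.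
Proof. exact: reprK. Qed.

Lemma repr_loop_class (p : loop) : path_homotopic (repr (loop_class p)) p.
Proof. by apply/loop_classP; rewrite loop_class_repr. Qed.

Definition pi1_one : pi1 := loop_class (cst_path R x).
Definition pi1_inv (a : pi1) : pi1 := loop_class (reverse (repr a)).
Definition pi1_mul (a b : pi1) : pi1 := loop_class (concat (repr a) (repr b)).

Lemma pi1_mulE (p q : loop) :
  pi1_mul (loop_class p) (loop_class q) = loop_class (concat p q).
Proof. by apply/loop_classP/concat_homotopic; exact: repr_loop_class. Qed.

Lemma pi1_invE (p : loop) : pi1_inv (loop_class p) = loop_class (reverse p).
Proof. by apply/loop_classP/reverse_homotopic/repr_loop_class. Qed.

Lemma pi1_mulA : associative pi1_mul.
Proof.
move=> a b c; rewrite -(loop_class_repr a) -(loop_class_repr b).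
rewrite -(loop_class_repr c) !pi1_mulE.
exact/loop_classP/concatA_homotopic.
Qed.

Lemma pi1_mul1 : left_id pi1_one pi1_mul.
Proof.
move=> a; rewrite -(loop_class_repr a) pi1_mulE.
exact/loop_classP/concat1p_homotopic.
Qed.

Lemma pi1_mulr1 : right_id pi1_one pi1_mul.
Proof.
move=> a; rewrite -(loop_class_repr a) pi1_mulE.
exact/loop_classP/concatp1_homotopic.
Qed.

Lemma pi1_mulV : left_inverse pi1_one pi1_inv pi1_mul.
Proof.
move=> a; rewrite -(loop_class_repr a) pi1_invE pi1_mulE.
exact/loop_classP/concatVp_homotopic.
Qed.

Lemma pi1_mulrV : right_inverse pi1_one pi1_inv pi1_mul.
Proof.
move=> a; rewrite -(loop_class_repr a) pi1_invE pi1_mulE.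
exact/loop_classP/concatpV_homotopic.
Qed.

HB.instance Definition _ := isGroup.Build pi1
  pi1_mulA pi1_mul1 pi1_mulr1 pi1_mulV pi1_mulrV.

(* The loop space carries the compact-open topology and pi1 is its quotient
   by loop_class. *)
Definition pi1_qtop : Type := quotient_topology pi1.

HB.instance Definition _ := Topological.on pi1_qtop.

Lemma pi1_qtop_openE (A : set pi1_qtop) :
  open A = open (loop_class @^-1` A : set loop).
Proof. by []. Qed.

End fundamental_group.

Definition is_subgroup (G : groupType) (H : set G) : Prop :=
  group_closed (mem H).

Definition group_core (G : groupType) (H : set G) : set G :=
  \bigcap_(g in [set: G]) [set (g^-1 * h * g)%g | h in H].

Lemma is_subgroupP (G : groupType) (H : set G) :
  is_subgroup H <->
  [/\ H 1%g, forall a b, H a -> H b -> H (a * b)%g & forall a, H a -> H a^-1%g].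
Proof.
split=> [gH|[H1 HM HV]].
  have [H1 _] := gH; split; first exact: set_mem.
    move=> a b Ha Hb; apply: set_mem.
    by apply: (group_closedM gH); exact: mem_set.
  by move=> a Ha; apply: set_mem; apply: (group_closedV gH); exact: mem_set.
split; first exact: mem_set.
move=> a b /set_mem Ha /set_mem Hb; apply: mem_set.
by apply: HM => //; exact: HV.
Qed.

Lemma group_core_subgroup (G : groupType) (H : set G) :
  is_subgroup H -> is_subgroup (group_core H).
Proof.
move=> /is_subgroupP[H1 HM HV]; apply/is_subgroupP; split.
- by move=> g _; exists 1%g => //; rewrite mulg1 mulVg.
- move=> a b Ha Hb g _.
  have [h Hh <-] := Ha g I; have [k Hk <-] := Hb g I.
  by exists (h * k)%g; [exact: HM|rewrite !mulgA mulgK].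
- move=> a Ha g _; have [h Hh <-] := Ha g I.
  by exists h^-1%g; [exact: HV|rewrite !invgM invgK mulgA].
Qed.

Section spanier.
Context (R : realType) (X : topologicalType).

Definition open_cover (I : Type) (U : I -> set X) : Prop :=
  (forall i, open (U i)) /\ cover [set: I] U = [set: X].

(* The data of a factor u v u^-1 of a Spanier product: u starts at x, and v is
   a loop at the endpoint of u contained in some member of the cover. *)
Record lasso (I : Type) (U : I -> set X) (x : X) := Lasso {
  lasso_pt : X;
  lasso_path : upath R x lasso_pt;
  lasso_loop : upath R lasso_pt lasso_pt;
  lasso_small : exists i, range lasso_loop `<=` U i }.

Definition lasso_class (I : Type) (U : I -> set X) (x : X) (l : lasso U x) :
    pi1 R x :=
  loop_class
    (concat (concat (lasso_path l) (lasso_loop l)) (reverse (lasso_path l))).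

(* The empty product adds nothing: for a cover it is also the class of the
   factor with u and v constant. *)
Definition spanier_group (I : Type) (U : I -> set X) (x : X) : set (pi1 R x) :=
  [set (\prod_(l <- s) lasso_class l)%g | s in [set: seq (lasso U x)]].

Arguments spanier_group {I} U x.

Lemma spanier_group_subgroup (I : Type) (U : I -> set X) (x : X) :
  is_subgroup (spanier_group U x).
Proof.
apply/is_subgroupP; split.
- by exists [::] => //; rewrite big_nil.
- by move=> _ _ [s _ <-] [t _ <-]; exists (s ++ t) => //; rewrite big_cat.
- move=> _ [s _ <-]; elim: s => [|l s [t _ tE]].
    by exists [::] => //; rewrite !big_nil invg1.
  rewrite big_cons invgM -tE.
  have small : exists i, range (reverse (lasso_loop l)) `<=` U i.
    have [i li] := lasso_small l; exists i => _ [u _ <-].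
    by apply: li; exists (clamp (1 - itv_val u)).
  exists (t ++ [:: Lasso (lasso_path l) small]) => //.
  rewrite big_cat big_seq1; congr (_ * _)%g.
  rewrite [RHS]pi1_invE; apply/loop_classP.
  rewrite !reverse_concat reverseK.
  exact/path_homotopic_sym/concatA_homotopic.
Qed.

Definition path_connected (A : set X) : Prop :=
  forall x y, A x -> A y -> exists p : upath R x y, range p `<=` A.

Definition locally_path_connected : Prop :=
  basis [set A : set X | open A /\ path_connected A].

End spanier.

Arguments spanier_group R {X I} U x.

(* Main.v *)
(* If the Spanier group S of an open cover U lies in H, it lies in the core of
   H, being normal. Loops q uniformly close to p satisfy [q][p]^-1 \in S: move
   along the parameter r while joining p(r) to q(r) by a short path c_r; each
   step changes the class of q|[0,r] c_r^-1 (p|[0,r])^-1 by a loop lying in one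
   member of U, conjugated by p|[0,r]. Hence any subgroup containing S is open.
   The step is reversible, so the set of reachable r is clopen in
   the real line and no subdivision is needed.
   Conversely, if the core N is open, take all open V such that every u v u^-1
   with v in V has class in N. They cover X: if u ends at y, a loop v that stays
   close to y makes u v u^-1 compact-open close to the null-homotopic u u^-1;
   local path connectedness and the normality of N then allow any other u. *)
Require Import Defs.
From mathcomp Require Import all_boot all_order all_algebra.
From mathcomp Require Import all_classical reals topology.
From mathcomp Require Import normedtype homotopy lra.
From Corelib Require Setoid.

Set Implicit Arguments.
Unset Strict Implicit.
Unset Printing Implicit Defensive.

Import Order.TTheory GRing.Theory Num.Theory.
Import numFieldNormedType.Exports.

Local Open Scope classical_set_scope.
Local Open Scope ring_scope.

(** * Path homotopy as a setoid relation, for rewriting inside words of paths *)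

Section path_homotopic_setoid.
Context (R : realType) (X : topologicalType).

#[global] Instance path_homotopic_equivalence (x y : X) :
  RelationClasses.Equivalence (@path_homotopic R X x y).
Proof.
split; [exact: path_homotopic_refl|exact: path_homotopic_sym|].
by move=> p q r; exact: path_homotopic_trans.
Qed.

#[global] Instance concat_proper (x y z : X) : Morphisms.Proper
  (Morphisms.respectful (@path_homotopic R X x y)
    (Morphisms.respectful (@path_homotopic R X y z) (@path_homotopic R X x z)))
  (@concat R X x y z).
Proof. by move=> p p' pp' q q'; exact: concat_homotopic. Qed.

#[global] Instance reverse_proper (x y : X) : Morphisms.Proper
  (Morphisms.respectful (@path_homotopic R X x y) (@path_homotopic R X y x))
  (@reverse R X x y).
Proof. by move=> p p'; exact: reverse_homotopic. Qed.

End path_homotopic_setoid.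

Section homotopy_algebra.
Context (R : realType) (X : topologicalType).

(** Cancellation rule for right-associated words, the form into which [-!concatA_homotopic] brings
    both sides of the path identities below. *)
Lemma concatKp_homotopic (x y z : X) (p : upath R x y) (q : upath R y z) :
  path_homotopic (concat (reverse p) (concat p q)) q.
Proof.
rewrite concatA_homotopic concatVp_homotopic concat1p_homotopic.
reflexivity.
Qed.

Lemma loop_classM (x : X) (p q : upath R x x) :
  (loop_class p * loop_class q)%g = loop_class (concat p q).
Proof. exact: pi1_mulE. Qed.

Lemma loop_classV (x : X) (p : upath R x x) :
  ((loop_class p)^-1)%g = loop_class (reverse p).
Proof. exact: pi1_invE. Qed.

Lemma range_concat (V : set X) (x y z : X) (p : upath R x y) (q : upath R y z) :
  range p `<=` V -> range q `<=` V -> range (concat p q) `<=` V.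
Proof.
move=> pV qV _ [t _ <-]; rewrite /concat/= /mk_path /concat_fun.
by case: ifP => _; [apply: pV|apply: qV]; exact: imageT.
Qed.

Lemma range_reverse (V : set X) (x y : X) (p : upath R x y) :
  range p `<=` V -> range (reverse p) `<=` V.
Proof. by move=> pV _ [t _ <-]; apply: pV; exact: imageT. Qed.

End homotopy_algebra.

(** * Pieces of a path between two parameters *)

Section sub_path.
Context (R : realType) (X : topologicalType) (x y : X).

Lemma path_clamp0 (p : upath R x y) : p (clamp 0) = x.
Proof. exact: path_zero. Qed.

Lemma path_clamp1 (p : upath R x y) : p (clamp 1) = y.
Proof. exact: path_one. Qed.

Section def.
Context (p : upath R x y) (a b : R).

(** Since [clamp] freezes the path outside the unit interval, [a] and [b] may be any reals; if
    [b < a], the piece runs backwards. *)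
Definition sub_path_fun (t : unit_itv R) : X :=
  p (clamp ((1 - itv_val t) * a + itv_val t * b)).

Lemma sub_path_continuous : continuous sub_path_fun.
Proof.
apply: path_clamp_continuous.
apply: continuous_segment_fun;
  [exact: itv_val_continuous|exact: cst_continuous..].
Qed.

Context {z w : X} (az : p (clamp a) = z) (bw : p (clamp b) = w).

Lemma sub_path_zero : sub_path_fun zero = z.
Proof. by rewrite /sub_path_fun itv_val0 subr0 mul1r mul0r addr0. Qed.

Lemma sub_path_one : sub_path_fun one = w.
Proof. by rewrite /sub_path_fun itv_val1 subrr mul1r mul0r add0r. Qed.

Definition sub_path : upath R z w :=
  mk_path sub_path_continuous sub_path_zero sub_path_one.

End def.

Lemma sub_path_refl (p : upath R x y) (a : R) (z : X)
    (e e' : p (clamp a) = z) :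
  path_homotopic (sub_path e e') (cst_path R z).
Proof.
apply: eqfun_homotopic => t /=; rewrite /sub_path/= /mk_path /sub_path_fun.
by rewrite -mulrDl subrK mul1r.
Qed.

Lemma sub_path01 (p : upath R x y)
    (e : p (clamp 0) = x) (e' : p (clamp 1) = y) :
  path_homotopic (sub_path e e') p.
Proof.
apply: eqfun_homotopic => t /=; rewrite /sub_path/= /mk_path /sub_path_fun.
by rewrite mulr0 add0r mulr1 itv_valK.
Qed.

(** Both sides reparametrize [p \o @clamp R] from [a] to [c], the left one along the broken line
    [phi] through [b], whatever the order of the three parameters. *)
Lemma concat_sub_path (p : upath R x y) (a b c : R) (z w v : X)
    (ez : p (clamp a) = z) (ew : p (clamp b) = w) (ev : p (clamp c) = v) :
  path_homotopic (concat (sub_path ez ew) (sub_path ew ev)) (sub_path ez ev).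
Proof.
pose phi (t : unit_itv R) : R := if itv_val t <= 2^-1
  then (a + (2 * itv_val t) * (b - a)) else (b + (2 * itv_val t - 1) * (c - b)).
apply: (@path_homotopic_param _ _ _ _ _ _ (p \o @clamp R) phi
  (fun t => (1 - itv_val t) * a + itv_val t * c)).
- exact: path_ext_continuous.
- apply: continuous_if_le.
  + exact: itv_val_continuous.
  + under eq_fun do rewrite addrC mulrAC.
    exact: itv_val_aff.
  + under eq_fun do rewrite addrC mulrBl mul1r mulrAC -addrA.
    exact: itv_val_aff.
  + by move=> t ->; lra.
- apply: continuous_segment_fun;
    [exact: itv_val_continuous|exact: cst_continuous..].
- move=> t /=; have /andP[t0 t1] := itv_valP t.
  rewrite /concat/= /mk_path /concat_fun /phi; case: leP => t12;
  rewrite /sub_path/= /mk_path /sub_path_fun clampK;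
    try (apply/andP; split; lra).
    by congr (p (clamp _)); lra.
  by congr (p (clamp _)); lra.
- by move=> t /=.
- by rewrite /phi itv_val0 invr_ge0 ler0n; lra.
- rewrite /phi itv_val1 ifF; first lra.
  by apply/negbTE; rewrite -ltNge; lra.
Qed.

Lemma range_sub_path (V : set X) (p : upath R x y) (a b : R) (z w : X)
    (ez : p (clamp a) = z) (ew : p (clamp b) = w) :
  [set p (clamp ((1 - t) * a + t * b)) | t in `[0, 1]%classic] `<=` V ->
  range (sub_path ez ew) `<=` V.
Proof.
move=> pV _ [t _ <-]; apply: pV; exists (itv_val t) => //.
by rewrite /= in_itv/= itv_valP.
Qed.

End sub_path.

(** * Spanier groups: lassos, normality and an inclusion criterion *)

Section spanier_facts.
Context (R : realType) (X : topologicalType).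
Context (J : Type) (U : J -> set X) (x : X).

Lemma spanier_lasso (y : X) (u : upath R x y) (v : upath R y y) (i : J) :
  range v `<=` U i ->
  spanier_group R U x (loop_class (concat (concat u v) (reverse u))).
Proof.
move=> vU; exists [:: Lasso u (ex_intro _ i vU)] => //.
by rewrite big_seq1.
Qed.

Lemma spanier_groupM (a b : pi1 R x) :
  spanier_group R U x a -> spanier_group R U x b ->
  spanier_group R U x (a * b)%g.
Proof.
by have [_ + _] := (is_subgroupP _).1 (spanier_group_subgroup R U x); apply.
Qed.

(** Conjugation acts factor by factor, and [g] is absorbed into the path of each lasso: g u v u^-1
    g^-1 = (g u) v (g u)^-1. *)
Lemma spanier_groupJ (a g : pi1 R x) :
  spanier_group R U x a -> spanier_group R U x (g * a * g^-1)%g.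
Proof.
have [S1 _ _] := (is_subgroupP _).1 (spanier_group_subgroup R U x).
move=> [s _ <-]; elim: s => [|l s IH].
  by rewrite big_nil mulg1 mulgV.
rewrite big_cons.
have -> : (g * (lasso_class l * \prod_(j <- s) lasso_class j) * g^-1 =
  (g * lasso_class l * g^-1) * (g * \prod_(j <- s) lasso_class j * g^-1))%g.
  by rewrite !mulgA mulgVK.
apply: spanier_groupM IH.
have [i li] := lasso_small l.
rewrite -(loop_class_repr g) /lasso_class loop_classV !loop_classM.
have -> : loop_class (concat (concat (repr g) (concat (concat (lasso_path l)
    (lasso_loop l)) (reverse (lasso_path l)))) (reverse (repr g))) =
  loop_class (concat (concat (concat (repr g) (lasso_path l)) (lasso_loop l))
    (reverse (concat (repr g) (lasso_path l)))).
  apply/loop_classP; rewrite reverse_concat -!concatA_homotopic.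
  reflexivity.
exact: spanier_lasso li.
Qed.

Lemma spanier_group_sub (N : set (pi1 R x)) :
    is_subgroup N ->
    (forall y (u : upath R x y) (v : upath R y y) i, range v `<=` U i ->
      N (loop_class (concat (concat u v) (reverse u)))) ->
  spanier_group R U x `<=` N.
Proof.
move=> /is_subgroupP[N1 NM _] NU _ [s _ <-].
elim: s => [|l s IH]; first by rewrite big_nil.
rewrite big_cons; apply: NM IH.
by have [i li] := lasso_small l; exact: NU li.
Qed.

End spanier_facts.

(** * Normality and maximality of the core *)

Section group_core_facts.
Context (G : groupType) (H : set G).

Lemma group_core_subset : group_core H `<=` H.
Proof. by move=> a /(_ 1%g I)[h Hh <-]; rewrite invg1 mul1g mulg1. Qed.

Lemma group_coreJ (a g : G) :
  group_core H a -> group_core H (g * a * g^-1)%g.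
Proof.
move=> Ha k _; have [h Hh ha] := Ha (k * g)%g I.
exists h => //; rewrite -ha invgM !mulgA mulgV mul1g.
by rewrite -!mulgA mulgV mulg1.
Qed.

Lemma sub_group_core (S : set G) :
    (forall a g, S a -> S (g * a * g^-1)%g) -> S `<=` H ->
  S `<=` group_core H.
Proof.
move=> SJ SH a Sa g _; exists (g * a * g^-1)%g; first exact/SH/SJ.
by rewrite -!mulgA mulVg mulg1 mulKg.
Qed.

End group_core_facts.

(** * Compact-open neighbourhoods of a path *)

Section path_space.
Context (R : realType) (X : topologicalType) (x y : X).

Lemma path_nbhs_filter (p : upath R x y) : Filter (nbhs p).
Proof. exact: nbhs_filter. Qed.

Lemma path_nbhs_image (p : upath R x y) (K : set (unit_itv R)) (O : set X) :
    compact K -> open O -> p @` K `<=` O ->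
  nbhs p [set q : upath R x y | q @` K `<=` O].
Proof.
move=> cK oO pKO.
apply: open_nbhs_nbhs; split => //.
by exists [set g | g @` K `<=` O]; [exact: compact_open_open|].
Qed.

Lemma path_nbhs_eval (p : upath R x y) (t : unit_itv R) (O : set X) :
  open O -> O (p t) -> nbhs p [set q : upath R x y | O (q t)].
Proof.
move=> oO pO; have : p @` [set t] `<=` O by move=> _ [_ -> <-].
move/(path_nbhs_image (@compact_set1 _ t) oO); apply: filterS => q qO.
by apply: qO; exists t.
Qed.

(** Paths carry the topology induced from the compact-open function space, so [A] is the trace of an
    open [B]; the last hypothesis makes [F] converge to [p], hence contain [B]. *)
Lemma open_path_space_cvg (F : set_system {compact-open, unit_itv R -> X})
    (p : upath R x y) (A : set (upath R x y)) :
    Filter F -> open A -> A p ->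
    (forall K O, compact K -> open O -> p @` K `<=` O ->
      F [set g | g @` K `<=` O]) ->
  exists2 B, F B & forall q : upath R x y, B q -> A q.
Proof.
move=> FF [B oB BA] Ap FK; exists B; last by move=> q; rewrite -BA.
have /(_ B) : F --> (p : {compact-open, unit_itv R -> X}).
  exact/compact_open_cvgP.
by apply; apply: open_nbhs_nbhs; split => //; rewrite -BA in Ap.
Qed.

End path_space.

(** * Local path connectedness; convexity and connectedness in the real line *)

Lemma locally_path_connected_nbhs (R : realType) (X : topologicalType)
    (y : X) (W : set X) :
  locally_path_connected R X -> open W -> W y ->
  exists V, [/\ open V, path_connected R V, V y & V `<=` W].
Proof.
move=> [_ /(_ y)] lpc oW Wy.
have [V [[oV cV] Vy] VW] := lpc W (open_nbhs_nbhs (conj oW Wy)).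
by exists V.
Qed.

Lemma segment_lt (R : realFieldType) (a b c t : R) :
  0 <= t <= 1 -> c < a -> c < b -> c < (1 - t) * a + t * b.
Proof.
move=> /andP[t0 t1] ca cb.
have [->|tN0] := eqVneq t 0; first lra.
have t_gt0 : 0 < t by rewrite lt_neqAle eq_sym tN0.
have h1 : 0 <= (1 - t) * (a - c) by apply: mulr_ge0; lra.
have h2 : 0 < t * (b - c) by apply: mulr_gt0; lra.
lra.
Qed.

Lemma nbhs_segment (R : realType) (r : R) (B : set R) : nbhs r B ->
  exists2 C, nbhs r C & forall a b t, C a -> C b -> `[0, 1]%classic t ->
    B ((1 - t) * a + t * b).
Proof.
move=> /nbhs_ballP[e /= e0 rB]; exists (ball r e); first exact: nbhsx_ballx.
move=> a b t; rewrite /ball/= !ltr_distlC => /andP[a1 a2] /andP[b1 b2].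
rewrite in_itv => t01; apply: rB; rewrite /ball/= ltr_distlC.
apply/andP; split; first exact: segment_lt.
(* The upper bound is the lower bound for the negated points. *)
have := @segment_lt R (- a) (- b) (- (r + e)) t t01.
rewrite !ltrN2 => /(_ a2 b2).
lra.
Qed.

(** The local condition is symmetric in [s] and [t], so both [A] and its complement are open. *)
Lemma clopen_setT (R : realType) (A : set R) :
  A !=set0 -> (forall r : R, exists2 B, nbhs r B &
    forall s t, B s -> B t -> A s -> A t) -> A = setT.
Proof.
move=> A0 Aloc; have cR : connected [set: R].
  by apply/connected_intervalP.
apply: cR => //; exists A; rewrite ?setTI//.
- rewrite openE => r Ar; have [B rB BA] := Aloc r.
  by apply: (filterS _ rB) => s Bs; apply: (BA r) => //; exact: nbhs_singleton.
- rewrite -openC openE => r nAr; have [B rB BA] := Aloc r.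
  apply: (filterS _ rB) => s Bs As; apply: nAr; apply: (BA s) => //.
  exact: nbhs_singleton.
Qed.

(** * Openness of the subgroups that contain a Spanier group *)

Section spanier_open.
Context (R : realType) (X : topologicalType).
Context (J : Type) (U : J -> set X) (x : X).
Hypothesis lpc : locally_path_connected R X.
Hypothesis oU : open_cover U.

(* The endpoints z = p(r) and w = q(r) are quantified up to equality so that at
   r = 1, where p(r) is only propositionally x, c can be taken as a loop at x. *)
Definition tracks (p q : upath R x x) (r : R) (W : set X) : Prop :=
  forall z w (ez : p (clamp r) = z) (ew : q (clamp r) = w),
  exists2 c : upath R z w, range c `<=` W &
    spanier_group R U x (loop_class
      (concat (concat (sub_path (path_clamp0 q) ew) (reverse c))
              (reverse (sub_path (path_clamp0 p) ez)))).

(** [W] is arbitrary so that a step may ask for a connecting path inside the set where it works and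
    return one inside any prescribed set. *)
Definition trackable (p : upath R x x) (r : R) : Prop :=
  forall W, open W -> W (p (clamp r)) -> nbhs p [set q | tracks p q r W].

Lemma trackable0 (p : upath R x x) : trackable p 0.
Proof.
move=> W oW Wp; apply: (filterS _ filterT) => q _ z w.
rewrite path_clamp0 in Wp.
move=> ez ew; have xz : x = z by rewrite -ez path_clamp0.
have xw : x = w by rewrite -ew path_clamp0.
case: z / xz ez => ez; case: w / xw ew => ew.
exists (cst_path R x); first by move=> _ [t _ <-].
have -> : loop_class (concat (concat (sub_path (path_clamp0 q) ew)
    (reverse (cst_path R x))) (reverse (sub_path (path_clamp0 p) ez))) = 1%g.
  apply/loop_classP; rewrite !sub_path_refl concat1p_homotopic.
  by rewrite -reverse_concat concat1p_homotopic; exact: eqfun_homotopic.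
by have [] := (is_subgroupP _).1 (spanier_group_subgroup R U x).
Qed.

(** No order is imposed on [a] and [b]: the step also runs backwards, as the clopen argument
    requires. *)
Lemma trackable_step (p : upath R x x) (a b : R) (V : set X) (i : J) :
    open V -> path_connected R V -> V `<=` U i ->
    [set p (clamp ((1 - t) * a + t * b)) | t in `[0, 1]%classic] `<=` V ->
  trackable p a -> trackable p b.
Proof.
move=> oV cV VU pV trp W oW Wpb.
have pVa : V (p (clamp a)).
  apply: pV; exists 0; first by rewrite /= in_itv/= lexx ler01.
  by congr (p (clamp _)); lra.
have pVb : V (p (clamp b)).
  apply: pV; exists 1; first by rewrite /= in_itv/= lexx ler01.
  by congr (p (clamp _)); lra.
have [W' [oW' cW' W'pb W'WV]] :=
  locally_path_connected_nbhs lpc (openI oW oV) (conj Wpb pVb).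
(* The parameters between [a] and [b] form a compact set, so keeping the image of [K] under [q]
   inside [V] is a compact-open condition on [q]. *)
pose K : set (unit_itv R) :=
  [set clamp ((1 - t) * a + t * b) | t in `[0, 1]%classic].
have cK : compact K.
  apply: continuous_compact; last exact: segment_compact.
  apply: continuous_subspaceT.
  apply: (@continuous_comp_fun _ _ _ (fun t : R => (1 - t) * a + t * b)).
    by apply: continuous_segment_fun;
      [move=> ?; exact: cvg_id|exact: cst_continuous..].
  exact: clamp_continuous.
have pKV : p @` K `<=` V.
  by move=> _ [_ [t t01 <-] <-]; apply: pV; exists t.
have Fp := path_nbhs_filter p.
apply: (filterS _ (filterI (trp V oV pVa)
  (filterI (path_nbhs_image cK oV pKV) (path_nbhs_eval oW' W'pb))))
  => q [/= trq [qKV W'qb]] z w ez ew.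
have [c cVc Sc] := trq _ _ erefl erefl.
have qV : [set q (clamp ((1 - t) * a + t * b)) | t in `[0, 1]%classic] `<=` V.
  move=> _ [t t01 <-]; apply: qKV.
  by exists (clamp ((1 - t) * a + t * b)) => //; exists t.
have [d dW'] : exists d : upath R z w, range d `<=` W'.
  by apply: cW'; rewrite -?ez -?ew.
exists d; first by move=> ? /dW' /W'WV[].
set p0a := sub_path (path_clamp0 p) (erefl (p (clamp a))) in Sc *.
set q0a := sub_path (path_clamp0 q) (erefl (q (clamp a))) in Sc *.
pose pab := sub_path (erefl (p (clamp a))) ez.
pose qab := sub_path (erefl (q (clamp a))) ew.
have pabV : range pab `<=` V by exact: range_sub_path.
have qabV : range qab `<=` V by exact: range_sub_path.
(* A loop at p(a): across to q(a), along q to q(b), back across to p(b), back along p. All four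
   sides lie in [V]. *)
pose v := concat c (concat qab (concat (reverse d) (reverse pab))).
have vU : range v `<=` U i.
  apply: (subset_trans _ VU); apply: range_concat => //.
  apply: range_concat => //; apply: range_concat; apply: range_reverse => //.
  by move=> ? /dW' /W'WV[].
(* In the product, the tail c^-1 p0a^-1 of the first factor cancels the head p0a c of the second,
   which is a lasso. *)
have -> : loop_class (concat (concat (sub_path (path_clamp0 q) ew) (reverse d))
      (reverse (sub_path (path_clamp0 p) ez))) =
  (loop_class (concat (concat q0a (reverse c)) (reverse p0a)) *
   loop_class (concat (concat p0a v) (reverse p0a)))%g.
  rewrite loop_classM; apply/loop_classP.
  rewrite -(concat_sub_path (path_clamp0 q) (erefl (q (clamp a))) ew).
  rewrite -(concat_sub_path (path_clamp0 p) (erefl (p (clamp a))) ez).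
  rewrite reverse_concat -!concatA_homotopic !concatKp_homotopic.
  reflexivity.
exact/spanier_groupM/(spanier_lasso _ vU).
Qed.

(** Trackability spreads from 0 over the whole line, on which [p \o @clamp R] is defined; near [r]
    that map stays in a path connected subset of one [U i]. *)
Lemma trackable1 (p : upath R x x) : trackable p 1.
Proof.
suff trT : [set r | trackable p r] = setT.
  by have : [set: R] 1 := I; rewrite -trT.
apply: clopen_setT; first by exists 0; exact: trackable0.
move=> r; have [oUi cU] := oU.
have [i _ Ui] : cover [set: J] U (p (clamp r)) by rewrite cU.
have [V [oV cV Vr VU]] := locally_path_connected_nbhs lpc (oUi i) Ui.
have /nbhs_segment[C rC CV] : nbhs r ((p \o @clamp R) @^-1` V).
  by apply: path_ext_continuous; exact: open_nbhs_nbhs.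
exists C => // s t Cs Ct; apply: (trackable_step oV cV VU).
by move=> _ [u u01 <-]; exact: CV.
Qed.

(** At parameter 1 both paths are back at [x], so [c] is a loop in [U i], and q p^-1 = (q c^-1
    p^-1)(p c p^-1) with both factors in the Spanier group. *)
Lemma spanier_nbhs (p : upath R x x) :
  nbhs p [set q | spanier_group R U x (loop_class q * (loop_class p)^-1)%g].
Proof.
have [oUi cU] := oU.
have [i _ Ui] : cover [set: J] U x by rewrite cU.
have : U i (p (clamp 1)) by rewrite path_clamp1.
have Fp := path_nbhs_filter p.
move=> /(trackable1 (oUi i)) trp; apply: (filterS _ trp) => q /= trq.
have [c cU' Sc] := trq _ _ (path_clamp1 p) (path_clamp1 q).
have -> : (loop_class q * (loop_class p)^-1)%g =
  (loop_class (concat (concat (sub_path (path_clamp0 q) (path_clamp1 q))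
      (reverse c)) (reverse (sub_path (path_clamp0 p) (path_clamp1 p)))) *
   loop_class (concat (concat p c) (reverse p)))%g.
  rewrite loop_classV !loop_classM; apply/loop_classP.
  rewrite !sub_path01 -!concatA_homotopic !concatKp_homotopic.
  reflexivity.
exact/spanier_groupM/(spanier_lasso _ cU').
Qed.

Lemma spanier_supergroup_open (N : set (pi1 R x)) :
  is_subgroup N -> spanier_group R U x `<=` N ->
  open (N : set (pi1_qtop R x)).
Proof.
move=> /is_subgroupP[_ NM _] SN; rewrite pi1_qtop_openE openE => p Np.
have Fp := path_nbhs_filter p.
apply: (filterS _ (spanier_nbhs p)) => q /SN Nqp.
rewrite /preimage/= -[loop_class q](mulgVK (loop_class p)).
exact: NM.
Qed.

End spanier_open.

(** * Finding a Spanier group inside an open normal subgroup *)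

Section spanier_cover.
Context (R : realType) (X : topologicalType) (x : X) (N : set (pi1 R x)).
Hypothesis lpc : locally_path_connected R X.
Hypothesis gN : is_subgroup N.
Hypothesis NJ : forall a g, N a -> N (g * a * g^-1)%g.
Hypothesis oN : open (N : set (pi1_qtop R x)).

Lemma open_small_loops (y : X) (u : upath R x y) :
  exists V, [/\ open V, V y & forall v : upath R y y, range v `<=` V ->
    N (loop_class (concat (concat u v) (reverse u)))].
Proof.
pose lasso v := concat (concat u v) (reverse u).
(* The filter of lassos whose loop shrinks to [y]; it converges to the lasso with constant loop,
   whose class is trivial and so in [N]. *)
pose F : set_system {compact-open, unit_itv R -> X} :=
  filter_from [set V | open V /\ V y]
    (fun V => [set (lasso v : unit_itv R -> X) |
       v in [set v : upath R y y | range v `<=` V]]).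
have FF : Filter F.
  apply: filter_from_filter; first by exists setT; split => //; exact: openT.
  move=> V W [oV Vy] [oW Wy]; exists (V `&` W); first by split; [exact: openI|].
  by move=> _ [v vVW <-]; split; exists v => // z /vVW[].
have [B [V [oV Vy] VB] BN] : exists2 B, F B &
    forall q : upath R x x, B q -> N (loop_class q).
  apply: (@open_path_space_cvg _ _ _ _ F (lasso (cst_path R y))) => //.
  - have -> : loop_class (lasso (cst_path R y)) = 1%g.
      apply/loop_classP; rewrite /lasso concatp1_homotopic concatpV_homotopic.
      reflexivity.
    by have [] := (is_subgroupP _).1 gN.
  - (* On the middle quarter the lasso with constant loop sits at y, so either
       O contains y and is a suitable V, or K avoids the middle quarter. *)
    move=> K O cK oO KO.
    have [yO|nyO] := pselect (O y).
      exists O => // _ [v vO <-] _ [t Kt <-].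
      have := KO _ (imageP _ Kt).
      rewrite /lasso /concat/= /mk_path /concat_fun.
      case: ifP => // _; rewrite /concat/= /mk_path /concat_fun.
      by case: ifP => // _ _; apply: vO; exact: imageT.
    exists setT; first by split => //; exact: openT.
    move=> _ [v _ <-] _ [t Kt <-].
    have := KO _ (imageP _ Kt).
    rewrite /lasso /concat/= /mk_path /concat_fun.
    case: ifP => // _; rewrite /concat/= /mk_path /concat_fun.
    by case: ifP.
by exists V; split => // v vV; apply: BN; apply: VB; exists v.
Qed.

Lemma exists_spanier_cover : exists (J : Type) (U : J -> set X),
  open_cover U /\ spanier_group R U x `<=` N.
Proof.
pose good V := open V /\
  forall z (u : upath R x z) (v : upath R z z), range v `<=` V ->
    N (loop_class (concat (concat u v) (reverse u))).
(* The cover consists of all good sets, indexed by themselves. *)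
exists {V | good V}, (@sval _ _); split; last first.
  by apply: spanier_group_sub => // y u v [V [oV VN]] /= /VN; exact.
split; first by move=> [V []].
rewrite -subTset => y _.
suff [V gV Vy] : exists2 V, good V & V y by exists (exist _ V gV).
have base (z : X) (V : set X) (v : upath R z z) : range v `<=` V -> V z.
  by apply; exists zero => //; exact: path_zero.
have [[a _]|na] := pselect (exists a : upath R x y, True).
  have [W [oW Wy WN]] := open_small_loops a.
  have [V [oV cV Vy VW]] := locally_path_connected_nbhs lpc oW Wy.
  exists V => //; split => // z u v vV.
  have [c cV'] := cV y z Vy (base _ _ _ vV).
  (* Since g a c = u, conjugation by [g] trades the arbitrary path [u] for the fixed path [a], with
     loop c v c^-1 at [y]. *)
  pose g := loop_class (concat u (concat (reverse c) (reverse a))).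
  have -> : loop_class (concat (concat u v) (reverse u)) =
      (g * loop_class (concat (concat a (concat (concat c v) (reverse c)))
                              (reverse a)) * g^-1)%g.
    rewrite /g loop_classV !loop_classM; apply/loop_classP.
    rewrite !reverse_concat !reverseK -!concatA_homotopic !concatKp_homotopic.
    reflexivity.
  apply/NJ/WN; apply: (subset_trans _ VW).
  by apply: range_concat; [exact: range_concat|exact: range_reverse].
(* With no path from [x] to [y], a path connected [V] around [y] is good vacuously: a path from [x]
   into [V] would extend to [y]. *)
have [V [oV cV Vy _]] := locally_path_connected_nbhs lpc openT (I : [set: X] y).
exists V => //; split => // z u v vV; exfalso; apply: na.
have [c _] := cV y z Vy (base _ _ _ vV).
by exists (concat u (reverse c)).
Qed.

End spanier_cover.

Theorem corollary3p6 (R : realType) (X : topologicalType) (x : X)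
    (H : set (pi1 R x)) :
  locally_path_connected R X ->
  is_subgroup H ->
  (exists (I : Type) (U : I -> set X),
     open_cover U /\ spanier_group R U x `<=` H)
  <-> open (group_core H : set (pi1_qtop R x)).
Proof.
move=> lpc gH; have gC := group_core_subgroup gH; split.
  move=> [J [U [oU UH]]]; apply: (spanier_supergroup_open lpc oU gC).
  by apply: sub_group_core => // a g; exact: spanier_groupJ.
move=> oC; have [J [U [oU UC]]] := exists_spanier_cover lpc gC
  (@group_coreJ _ H) oC.
by exists J, U; split=> // a /UC; exact: group_core_subset.
Qed.
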